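(* (i) Let $n\ge 2$, let $a=(a_1,\dots,a_n)^T\in\mathbb{Z}^n$ have all entries nonzero and $\gcd(a_1,\dots,a_n)=1$, and let $c\in\mathbb{Q}^n$. Then $$\mathrm{Gap}(c,a)\le(\|a\|_\infty-1)\,\|c\|_1 .$$ (ii) For any positive integer $k$ and any dimension $n\ge 2$ there exist $a\in\mathbb{Z}^n$ with all entries nonzero, $\gcd(a_1,\dots,a_n)=1$ and $\|a\|_\infty=k$, and $c\in\mathbb{Q}^n$, such that $$\mathrm{Gap}(c,a)=(\|a\|_\infty-1)\,\|c\|_1 .$$
   Context: For $a\in\mathbb{Z}^n$ and $b\in\mathbb{Z}$ let $P(a,b)=\{x\in\mathbb{R}^n_{\ge 0}: a^Tx=b\}$. For $c\in\mathbb{Q}^n$ consider the integer knapsack problem $\min\{c^Tx: x\in P(a,b)\cap\mathbb{Z}^n\}$ with optimal value $IP(c,a,b)$, and its linear programming relaxation $\min\{c^Tx: x\in P(a,b)\}$ with optimal value $LP(c,a,b)$. The integrality gap is $IG(c,a,b)=IP(c,a,b)-LP(c,a,b)$, and the integer programming gap is $$\mathrm{Gap}(c,a)=\max_b IG(c,a,b),$$ where $b$ ranges over all integers such that the integer knapsack problem is feasible and bounded. It is a standing assumption that only $(c,a)$ for which such $b$ exist are considered. $\|\cdot\|_1$ and $\|\cdot\|_\infty$ are the $\ell_1$- and $\ell_\infty$-norms. *)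

(* Defs.v *)
From HB Require Import structures.
From mathcomp Require Import all_boot all_order all_algebra.
From mathcomp Require Import boolp classical_sets reals ereal.
From mathcomp Require Import topology normedtype.
Set Implicit Arguments.
Unset Strict Implicit.
Unset Printing Implicit Defensive.
Import Order.TTheory GRing.Theory Num.Theory.
Local Open Scope classical_set_scope.
Local Open Scope ring_scope.

Definition dotv (R : pzRingType) (n : nat) (u v : 'cV[R]_n) : R :=
  (u^T *m v) 0 0.

(* The max-norm is the library's [mx_norm]. *)
Definition l1norm (R : numDomainType) (n : nat) (u : 'cV[R]_n) : R :=
  \sum_i `|u i 0|.

Definition gcdv (n : nat) (a : 'cV[int]_n) : nat :=
  \big[gcdn/0%N]_i absz (a i 0).

Definition knapsack_polyhedron (R : realType) (n : nat) (a : 'cV[int]_n)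
    (b : int) : set 'cV[R]_n :=
  [set x : 'cV[R]_n | (forall i, 0 <= x i 0) /\ dotv (map_mx intr a) x = b%:~R].
Arguments knapsack_polyhedron R {n} a b.

Definition integer_points (R : realType) (n : nat) : set 'cV[R]_n :=
  [set x : 'cV[R]_n | x \is a mxOver Num.int].
Arguments integer_points R n : clear implicits.

Definition knapsack_feasible_set (R : realType) (n : nat) (a : 'cV[int]_n)
    (b : int) : set 'cV[R]_n :=
  knapsack_polyhedron R a b `&` integer_points R n.
Arguments knapsack_feasible_set R {n} a b.

Definition objective (R : realType) (n : nat) (c : 'cV[rat]_n)
    (x : 'cV[R]_n) : R :=
  dotv (map_mx ratr c) x.

(* Optimal values are extended real: +oo if infeasible, -oo if unbounded. *)
Definition IP (R : realType) (n : nat) (c : 'cV[rat]_n) (a : 'cV[int]_n)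
    (b : int) : \bar R :=
  ereal_inf [set (objective c x)%:E | x in knapsack_feasible_set R a b].

Definition LP (R : realType) (n : nat) (c : 'cV[rat]_n) (a : 'cV[int]_n)
    (b : int) : \bar R :=
  ereal_inf [set (objective c x)%:E | x in knapsack_polyhedron R a b].

Definition IG (R : realType) (n : nat) (c : 'cV[rat]_n) (a : 'cV[int]_n)
    (b : int) : \bar R :=
  (IP R c a b - LP R c a b)%E.

Definition feasible_bounded (R : realType) (n : nat) (c : 'cV[rat]_n)
    (a : 'cV[int]_n) : set int :=
  [set b | knapsack_feasible_set R a b !=set0 /\
           has_lbound [set objective c x | x in knapsack_feasible_set R a b]].

(* A set without a greatest element gets the value +oo, so that a finite upper
   bound on [emax A] also asserts that the maximum is attained. *)
Definition emax (R : realType) (A : set (\bar R)) : \bar R :=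
  xget (+oo%E) [set m | A m /\ ubound A m].

Definition Gap (R : realType) (n : nat) (c : 'cV[rat]_n) (a : 'cV[int]_n) :
    \bar R :=
  emax [set IG R c a b | b in feasible_bounded R c a].

(* Main.v *)
Require Import Defs.
From HB Require Import structures.
From mathcomp Require Import all_boot all_order all_algebra.
From mathcomp Require Import boolp classical_sets reals ereal.
From mathcomp Require Import topology normedtype.
From mathcomp Require Import zify lra ring.
Set Implicit Arguments.
Unset Strict Implicit.
Unset Printing Implicit Defensive.
Import Order.TTheory GRing.Theory Num.Theory.
Local Open Scope classical_set_scope.
Local Open Scope ring_scope.

(** A bounded feasible problem has, by linear programming duality for a single
    constraint, an optimal vertex [(b / a_j) e_j], where after replacing
    [(a, b)] by [(-a, -b)] we may assume [0 <= b] and [0 < a_j].  Among the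
    integer points of [P(a, b)] choose [z] with [\sum_(i <> j) z_i] minimal.
    Any [m] integers have a nonempty subfamily whose sum is divisible by [m];
    applied with [m = |a_q|] to coordinates of equal sign, this gives kernel
    vectors that could be subtracted from [z], and minimality then yields
    [|z_i - x_i| <= ||a||_oo - 1] for all [i], [x] being the vertex.  Optimal
    values have bounded denominators, so the maximum defining the gap is attained.
    Equality holds for [a = (k, ..., k, 1)], [c = e_n] and [b = k - 1]. *)

(** * Zero-sum subfamilies modulo [m] *)

Lemma sumn_countM (I : finType) (f : I -> nat) (s : seq I) :
  (\sum_(i <- s) f i = \sum_i count_mem i s * f i)%N.
Proof.
elim: s => [|x s IHs]; first by rewrite big_nil big1.
rewrite big_cons IHs /=; under [RHS]eq_bigr do rewrite mulnDl.
rewrite big_split /=; congr addn; rewrite (bigD1 x)//= eqxx mul1n big1 ?addn0// => i.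
by rewrite eq_sym => /negPf->.
Qed.

(** Pigeonhole on the [m + 1] prefix sums of lengths 0 to [m], taken modulo [m]: two of them agree,
    and the block between them has sum divisible by [m]. *)
Lemma zero_sum_subseq (I : eqType) (f : I -> nat) (s : seq I) (m : nat) :
  (0 < m <= size s)%N ->
  exists t : seq I, [/\ subseq t s, (0 < size t <= m)%N &
    (m %| \sum_(i <- t) f i)%N].
Proof.
move=> /andP[m0 ms].
pose pre k := (\sum_(i <- take k s) f i)%N.
pose F (k : 'I_m.+1) : 'I_m := Ordinal (ltn_pmod (pre k) m0).
have /injectivePn[i [j neq_ij eqF]] : ~~ injectiveb F.
  apply/negP => /injectiveP/leq_card; rewrite !card_ord; lia.
wlog lt_ij : i j neq_ij eqF / (i < j)%N.
  move=> H; have : val i != val j by [].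
  rewrite neq_ltn => /orP[|] lt; first exact: (H i j).
  by apply: (H j i) => //; rewrite eq_sym.
have jm : (j <= m)%N by rewrite -ltnS.
have E : take j s = take i s ++ take (j - i) (drop i s).
  by rewrite -{1}(subnKC (ltnW lt_ij)) takeD.
exists (take (j - i) (drop i s)); split.
- exact: subseq_trans (take_subseq _ _) (drop_subseq _ _).
- rewrite size_take_min size_drop; lia.
move: eqF => /(congr1 val) /= /eqP; rewrite eq_sym eqn_mod_dvd; last first.
  by rewrite /pre E big_cat leq_addr.
by rewrite /pre E big_cat addKn.
Qed.

(** Multiset form of the pigeonhole argument: each index [i] of [S] is listed [z i] times, and [u]
    counts multiplicities in the extracted sublist. *)
Lemma zero_sum_vector (I : finType) (S : pred I) (f z : I -> nat) (m : nat) :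
  (0 < m)%N -> (m <= \sum_(i | S i) z i)%N ->
  exists u : I -> nat, [/\ forall i, (u i <= z i)%N,
    forall i, ~~ S i -> u i = 0%N,
    (0 < \sum_i u i <= m)%N & (m %| \sum_i u i * f i)%N].
Proof.
move=> m0 mz.
pose s := flatten [seq nseq (z i) i | i <- enum S].
have cs i : count_mem i s = if S i then z i else 0%N.
  rewrite /s count_flatten -map_comp sumnE big_map big_enum /= big_mkcond /=.
  rewrite (bigD1 i)//= big1 ?addn0 => [|k]; first by rewrite count_nseq /= eqxx mul1n.
  by move=> /negPf ki; rewrite count_nseq /= ki mul0n; case: ifP.
have ss : (m <= size s)%N.
  rewrite /s size_flatten /shape -map_comp sumnE big_map big_enum.
  by under eq_bigr do rewrite /= size_nseq.
have [|t [ts tm mt]] := @zero_sum_subseq _ f s m; first by rewrite m0.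
exists (fun i => count_mem i t); split.
- move=> i; apply: leq_trans (leq_count_subseq _ ts) _.
  by rewrite cs; case: ifP.
- move=> i /negPf Si; apply/eqP; rewrite -leqn0.
  by apply: leq_trans (leq_count_subseq _ ts) _; rewrite cs Si.
- rewrite (_ : (\sum_i _)%N = size t)// -sum1_size [RHS]sumn_countM.
  by under [RHS]eq_bigr do rewrite muln1.
by rewrite -sumn_countM.
Qed.

(** * Proximity of an integer point to a vertex *)

Lemma Posz_sum (I : finType) (P : pred I) (f : I -> nat) :
  (\sum_(i | P i) f i)%N%:Z = \sum_(i | P i) (f i)%:Z.
Proof. exact: (big_morph Posz PoszD erefl). Qed.

Lemma sum_addDelta (I : finType) (P : pred I) (a u : I -> int) (l : I) (c : int) :
  \sum_(i | P i) a i * (u i + c *+ (i == l)) =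
  \sum_(i | P i) a i * u i + (a l * c) *+ P l.
Proof.
under eq_bigr do rewrite mulrDr.
rewrite big_split /=; congr (_ + _).
rewrite big_mkcond (bigD1 l)//= eqxx big1 ?addr0 => [|i /negPf->].
  by case: (P l).
by rewrite mulr0n mulr0 if_same.
Qed.

Section Proximity.
Variables (I : finType) (a : I -> int) (A : nat).
Hypotheses (a0 : forall i, a i != 0) (aA : forall i, (absz (a i) <= A)%N).

(** When [m] is some [|a q|], adding or subtracting [t] copies of [q] turns [u] into a kernel
    vector. Here [t] is positive because [u] is nonzero and no coefficient vanishes, and [t <= A]
    because [u] has total at most [m]. *)
Lemma zero_sum_signed (S : pred I) (s : int) (z : I -> nat) (m : nat) :
  (forall i, S i -> a i = s * `|a i|%N%:Z) ->
  (0 < m)%N -> (m <= \sum_(i | S i) z i)%N ->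
  exists (u : I -> nat) (t : nat), [/\ forall i, (u i <= z i)%N,
    forall i, ~~ S i -> u i = 0%N, (0 < t <= A)%N &
    \sum_i a i * (u i)%:Z = s * t%:Z * m%:Z].
Proof.
move=> aS m0 mz.
have [u [uz uS /andP[u0 um] /dvdnP[t tE]]] :=
  zero_sum_vector (fun i => absz (a i)) m0 mz.
exists u, t; split=> //.
  apply/andP; split.
    case: t tE => // /eqP; rewrite mul0n sum_nat_eq0 => /forallP/= ua0.
    move: u0; rewrite lt0n sum_nat_eq0 => /negP[].
    apply/forallP => i; have := ua0 i; rewrite muln_eq0 absz_eq0.
    by rewrite (negPf (a0 i)) orbF.
  rewrite -(leq_pmul2r m0) -tE (leq_trans _ (leq_mul (leqnn A) um))//.
  by rewrite big_distrr leq_sum// => i _; rewrite mulnC leq_mul.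
rewrite -mulrA -PoszM -tE Posz_sum big_distrr; apply: eq_bigr => i _ /=.
have [Si|/uS->] := boolP (S i); last by rewrite mul0n !mulr0.
by rewrite {1}(aS _ Si) PoszM [(u i)%:Z * _]mulrC mulrA.
Qed.

Variables (b : int) (j : I).
Hypotheses (b0 : 0 <= b) (aj0 : 0 < a j).

(** The vertex is [(b / a j) e_j], with zero coordinates off [j]; the last bound is
    [|z j - b / a j| <= A - 1] multiplied by [a j]. *)
Lemma proximity (z0 : I -> nat) : \sum_i a i * (z0 i)%:Z = b ->
  exists z : I -> nat, [/\ \sum_i a i * (z i)%:Z = b,
    forall i, i != j -> (z i < A)%N &
    `|a j * (z j)%:Z - b| <= (A%:Z - 1) * a j].
Proof.
move=> z0b.
pose feas (z : I -> nat) := \sum_i a i * (z i)%:Z = b.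
pose wt (z : I -> nat) := (\sum_(i | i != j) z i)%N.
have ex_wt : exists k, `[< exists2 z, feas z & wt z = k >].
  by exists (wt z0); apply/asboolP; exists z0.
have [k /asboolP[z zb zk] kmin] := ex_minnP ex_wt.
(* For a kernel vector [u] below [z], the point [z - u] is again feasible, so minimality forbids a
   drop of the weight off [j]. *)
have reduce (u : I -> int) : (forall i, u i <= (z i)%:Z) ->
    \sum_i a i * u i = 0 -> \sum_(i | i != j) u i <= 0.
  move=> uz u0; pose v i := absz ((z i)%:Z - u i).
  have vE i : (v i)%:Z = (z i)%:Z - u i by rewrite /v gez0_abs// subr_ge0.
  have vb : feas v.
    rewrite /feas; under eq_bigr do rewrite vE mulrBr.
    by rewrite sumrB u0 subr0.
  have : (k <= wt v)%N by apply: kmin; apply/asboolP; exists v.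
  rewrite -zk -lez_nat /wt !Posz_sum.
  by rewrite [leRHS](eq_bigr _ (fun i _ => vE i)) sumrB lerBrDr gerDl.
(* All kernel vectors used below have the shape [u + c e_l]. *)
have {reduce}no_reduction (u : I -> nat) (l : I) (c : int) :
    (forall i, (u i)%:Z + c *+ (i == l) <= (z i)%:Z) ->
    \sum_i a i * (u i)%:Z + a l * c = 0 ->
    \sum_(i | i != j) (u i)%:Z + c *+ (l != j) <= 0.
  move=> uz u0; have := reduce _ uz.
  rewrite sum_addDelta mulr1n => /(_ u0).
  have := sum_addDelta (fun i => i != j) (fun=> 1) (fun i => (u i)%:Z) l c.
  under eq_bigr do rewrite mul1r.
  by under [X in _ = X + _]eq_bigr do rewrite mul1r; rewrite mul1r => ->.
(* Provides the strict decrease when [u] avoids [j]. *)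
have sum_gt0 (u : I -> nat) (t : int) : u j = 0%N -> t != 0 ->
    \sum_i a i * (u i)%:Z = t -> 0 < \sum_(i | i != j) (u i)%:Z.
  move=> uj t0 ut; rewrite lt_def sumr_ge0 ?andbT; last by [].
  apply: contra_neq t0 => /eqP; rewrite psumr_eq0// => /allP u0.
  rewrite -ut big1 // => i _; have [->|ij] := eqVneq i j.
    by rewrite uj mulr0.
  by have := u0 i; rewrite mem_index_enum ij/= => /(_ isT)/eqP ->; rewrite mulr0.
have ajA : a j <= A%:Z by have := aA j; lia.
have posE i : 0 < a i -> a i = 1 * `|a i|%N%:Z by lia.
have negE i : a i < 0 -> a i = -1 * `|a i|%N%:Z by lia.
have mj : (0 < `|a j|)%N by lia.
have mE : `|a j|%N%:Z = a j by rewrite gtz0_abs.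
(* Otherwise some [u] on these coordinates has sum [t * a j], and subtracting [u - t e_j]
   contradicts minimality; coordinate [j] may grow because it carries no weight. *)
have sumP : (\sum_(i | (i != j) && (0 < a i)%R) z i < `|a j|)%N.
  rewrite ltnNge; apply/negP => le_m.
  have [|u [t [uz uS /andP[t0 tA] ut]]] := zero_sum_signed (s := 1) _ mj le_m.
    by move=> i /andP[_ /posE].
  have uj : u j = 0%N by apply: uS; rewrite eqxx.
  have : \sum_(i | i != j) (u i)%:Z + (- t%:Z) *+ (j != j) <= 0.
    apply: no_reduction; last by rewrite ut mE mul1r mulrN mulrC subrr.
    move=> i; have [->|_] := eqVneq i j; first by rewrite uj mulr1n; lia.
    by rewrite addr0 lez_nat.
  by rewrite eqxx addr0 leNgt (sum_gt0 _ _ _ _ ut)// mE mul1r mulf_neq0; lia.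
(* As [0 <= b], a large [z q] forces at least [`|a q|] units of positive
   coefficients, some of which cancel against copies of [q]. *)
have sumN q : a q < 0 -> (z q < A)%N.
  move=> aq; rewrite ltnNge; apply/negP => Azq.
  have mq : (0 < `|a q|)%N by lia.
  (* With [N] the total over positive coefficients, [0 <= b] gives
     [|a q| * A <= |a q| * z q <= A * N]; then cancel [A]. *)
  have le_m : (`|a q| <= \sum_(i | (0 < a i)%R) z i)%N.
    have DN : \sum_(i | ~~ (0 < a i)) a i * (z i)%:Z <= a q * (z q)%:Z.
      rewrite (bigD1 q) ?gerDl ?sumr_le0//=; last by lia.
      by move=> i /andP[/negP ai _]; nia.
    have DP : \sum_(i | 0 < a i) a i * (z i)%:Z <=
        A%:Z * (\sum_(i | (0 < a i)%R) z i)%N%:Z.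
      rewrite Posz_sum mulr_sumr ler_sum// => i ai.
      by have := aA i; nia.
    have := zb; rewrite /feas (bigID (fun i => 0 < a i))/=; move: DN DP.
    move: (\sum_(i | ~~ (0 < a i)) a i * (z i)%:Z) (\sum_(i | 0 < a i) a i * (z i)%:Z)
      (\sum_(i | (0 < a i)%R) z i)%N => x y N.
    move=> xle yle xy.
    have h : - a q * A%:Z <= - a q * (z q)%:Z by rewrite ler_wpM2l; lia.
    have : A%:Z * - a q <= A%:Z * N%:Z.
      by rewrite mulrC (le_trans h)// (le_trans _ yle)// mulNr; lia.
    by rewrite ler_pM2l; have := aA q; lia.
  have [|u [t [uz uS /andP[t0 tA] ut]]] := zero_sum_signed (s := 1) _ mq le_m.
    by move=> i /posE.
  have qj : q != j by apply: contraTneq aq => ->; lia.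
  have uq : u q = 0%N by apply: uS; lia.
  (* The kernel vector [u + t e_q] lies below [z] since [t <= A <= z q]. As [u] may involve [j], the
     strict decrease is read off at [q]. *)
  have : \sum_(i | i != j) (u i)%:Z + t%:Z *+ (q != j) <= 0.
    apply: no_reduction; last by rewrite ut; lia.
    move=> i; have [->|_] := eqVneq i q; first by rewrite uq mulr1n; lia.
    by rewrite addr0 lez_nat.
  have : 0 <= \sum_(i | i != j) (u i)%:Z by rewrite sumr_ge0.
  by rewrite qj mulr1n; lia.
exists z; split=> // [i ij|].
  have [ai|ai] := ltP 0 (a i); last by apply: sumN; have := a0 i; lia.
  have : (z i <= \sum_(i | (i != j) && (0 < a i)%R) z i)%N.
    by rewrite (bigD1 i) ?leq_addr// ij.
  lia.
(* A total of at most [a j - 1] contributes at most [A * (a j - 1)], which is at most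
   [(A - 1) * a j] because [a j <= A]. *)
have bound (S : pred I) : (\sum_(i | S i) z i < `|a j|)%N ->
    \sum_(i | S i) `|a i|%N%:Z * (z i)%:Z <= (A%:Z - 1) * a j.
  move=> Sm; apply: (@le_trans _ _ (A%:Z * (\sum_(i | S i) z i)%N%:Z)); last by nia.
  rewrite Posz_sum mulr_sumr ler_sum// => i _.
  by rewrite ler_wpM2r// lez_nat.
have DE : b - a j * (z j)%:Z =
    \sum_(i | (i != j) && (0 < a i)) `|a i|%N%:Z * (z i)%:Z -
    \sum_(i | ~~ (0 < a i)) `|a i|%N%:Z * (z i)%:Z.
  rewrite -zb (bigD1 j)//= addrAC subrr add0r (bigID (fun i => 0 < a i))/= -sumrN.
  congr (_ + _); first by apply: eq_bigr => i /andP[_ ai]; rewrite gtz0_abs.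
  apply: eq_big => i; first by have [->|] := eqVneq i j; rewrite ?aj0.
  by move=> /andP[_ ai]; rewrite ltz0_abs ?mulNr ?opprK//; have := a0 i; lia.
(* The bound on the negative part [Y] stays conditional: the total over negative coefficients can
   reach [a j]. *)
have [X [Y [{}DE X0 Xub Y0 Yub]]] : exists X Y : int,
    [/\ b - a j * (z j)%:Z = X - Y, 0 <= X, X <= (A%:Z - 1) * a j, 0 <= Y &
        (\sum_(i | ~~ (0 < a i)%R) z i < `|a j|)%N -> Y <= (A%:Z - 1) * a j].
  by do 2!eexists; split; [exact: DE|exact: sumr_ge0|exact: bound|
    exact: sumr_ge0|exact: bound].
rewrite distrC DE.
have [/Yub{}Yub|sN] := ltnP (\sum_(i | ~~ (0 < a i)%R) z i) `|a j|%N.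
  by rewrite ler_norml; apply/andP; split; lia.
(* Now [u + t e_j] is a kernel vector, so minimality forces [z j < t <= A]. With [0 <= b] this
   bounds [a j * z j - b], while [X] alone bounds [b - a j * z j]. *)
have [|u [t [uz uS /andP[t0 tA] ut]]] := zero_sum_signed (s := -1) _ mj sN.
  by move=> i ai; apply: negE; have := a0 i; lia.
have uj : u j = 0%N by apply: uS; rewrite aj0.
have zjt : (z j < t)%N.
  rewrite ltnNge; apply/negP => tz.
  have : \sum_(i | i != j) (u i)%:Z + t%:Z *+ (j != j) <= 0.
    apply: no_reduction; last by rewrite ut mE; lia.
    move=> i; have [->|_] := eqVneq i j; first by rewrite uj mulr1n; lia.
    by rewrite addr0 lez_nat.
  by rewrite eqxx addr0 leNgt (sum_gt0 _ _ _ _ ut)// mE mulf_neq0; lia.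
have : a j * (z j)%:Z <= (A%:Z - 1) * a j by rewrite mulrC ler_wpM2r; lia.
by rewrite ler_norml => ?; apply/andP; split; lia.
Qed.
End Proximity.

(** * Attained minima and the coordinate form of the problem *)

(** The numbers [d * x] are integers not below [Num.floor (d * l)]; the least offset from it exists
    by well-ordering of [nat]. *)
Lemma discrete_min (F : archiRealFieldType) (S : set F) (d l : F) :
  0 < d -> S !=set0 -> lbound S l -> (forall x, S x -> d * x \is a Num.int) ->
  exists2 m, S m & lbound S m.
Proof.
move=> d0 [x0 Sx0] Sl Sint.
have val x : S x -> exists k : nat, d * x = (Num.floor (d * l))%:~R + k%:R.
  move=> Sx; have /intrP[m dx] := Sint _ Sx.
  have : Num.floor (d * l) <= m.
    by rewrite -(ler_int F) -dx (le_trans (floor_le _))// ler_wpM2l ?Sl// ltW.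
  move=> fm; exists (absz (m - Num.floor (d * l))).
  have mE : m = Num.floor (d * l) + `|m - Num.floor (d * l)|%N%:Z by lia.
  by rewrite dx {1}mE intrD.
have ex_k : exists k, `[< exists2 x, S x & d * x = (Num.floor (d * l))%:~R + k%:R >].
  by have [k xk] := val _ Sx0; exists k; apply/asboolP; exists x0.
have [k /asboolP[m Sm mk] kmin] := ex_minnP ex_k.
exists m => // x Sx; have [k' xk'] := val _ Sx.
have : (k <= k')%N by apply: kmin; apply/asboolP; exists x.
by rewrite -(ler_pM2l d0) mk xk' lerD2l ler_nat.
Qed.

Lemma dotvE (R : pzRingType) (n : nat) (u v : 'cV[R]_n) :
  dotv u v = \sum_i u i 0 * v i 0.
Proof. by rewrite /dotv mxE; apply: eq_bigr => i _; rewrite mxE. Qed.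

Lemma objectiveE (R : realType) (n : nat) (c : 'cV[rat]_n) (x : 'cV[R]_n) :
  objective c x = \sum_i ratr (c i 0) * x i 0.
Proof. by rewrite /objective dotvE; apply: eq_bigr => i _; rewrite mxE. Qed.

Lemma polyhedronE (R : realType) (n : nat) (a : 'cV[int]_n) (b : int) (x : 'cV[R]_n) :
  knapsack_polyhedron R a b x <->
  (forall i, 0 <= x i 0) /\ \sum_i (a i 0)%:~R * x i 0 = b%:~R :> R.
Proof.
suff -> : \sum_i (a i 0)%:~R * x i 0 = dotv (map_mx intr a) x by [].
by rewrite dotvE; apply: eq_bigr => i _; rewrite mxE.
Qed.

Lemma polyhedronN (R : realType) (n : nat) (a : 'cV[int]_n) (b : int) :
  knapsack_polyhedron R (- a) (- b) = knapsack_polyhedron R a b.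
Proof.
have oppE (x : 'cV[R]_n) : \sum_i ((- a) i 0)%:~R * x i 0 =
    - \sum_i (a i 0)%:~R * x i 0.
  by rewrite -sumrN; apply: eq_bigr => i _; rewrite mxE rmorphN mulNr.
apply/seteqP; split=> x /polyhedronE[x0 xb]; apply/polyhedronE; split=> //.
  by apply: oppr_inj; rewrite -oppE xb rmorphN.
by rewrite oppE xb rmorphN.
Qed.

(** Every feasible integer point has this form, which transfers results on functions into [nat] to
    the real polyhedron. *)
Definition natv (R : realType) (n : nat) (z : 'I_n -> nat) : 'cV[R]_n :=
  \col_i (z i)%:R.
Arguments natv R {n} z.

Lemma natv_feasible (R : realType) (n : nat) (a : 'cV[int]_n) (b : int)
    (z : 'I_n -> nat) :
  knapsack_feasible_set R a b (natv R z) <-> \sum_i a i 0 * (z i)%:Z = b.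
Proof.
have E : \sum_i (a i 0)%:~R * natv R z i 0 = (\sum_i a i 0 * (z i)%:Z)%:~R.
  by rewrite rmorph_sum; apply: eq_bigr => i _; rewrite mxE rmorphM.
split=> [[/polyhedronE[_ zb] _]|zb].
  by apply: (@intr_inj R); rewrite -E.
split; first by apply/polyhedronE; split=> [i|]; rewrite ?E ?zb// mxE.
by apply/mxOverP => i k; rewrite mxE natr_int.
Qed.

Lemma feasible_natv (R : realType) (n : nat) (a : 'cV[int]_n) (b : int) (x : 'cV[R]_n) :
  knapsack_feasible_set R a b x -> exists z, x = natv R z.
Proof.
move=> [/polyhedronE[x0 _] /mxOverP xint].
have /choice[z zE] : forall i, exists k : nat, x i 0 = k%:R.
  by move=> i; apply/natrP; rewrite natrEint xint x0.
by exists z; apply/matrixP => i k; rewrite ord1 mxE zE.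
Qed.

Lemma objective_natv (R : realType) (n : nat) (c : 'cV[rat]_n) (z : 'I_n -> nat) :
  objective c (natv R z) = ratr (\sum_i c i 0 * (z i)%:R).
Proof.
rewrite objectiveE rmorph_sum; apply: eq_bigr => i _.
by rewrite mxE rmorphM /= ratr_nat.
Qed.

(** * Optimal values of the relaxation and of the integer problem *)

Lemma ereal_inf_min (R : realType) (T : Type) (S : set T) (f : T -> R) (x : T) :
  S x -> (forall y, S y -> f x <= f y) ->
  ereal_inf [set (f x)%:E | x in S] = (f x)%:E.
Proof.
move=> Sx fx; apply/eqP; rewrite eq_le; apply/andP; split.
  by apply: ereal_inf_lbound; exists x.
by apply: le_ereal_inf_tmp => _ [y Sy <-]; rewrite lee_fin fx.
Qed.

(* Otherwise the objective would tend to [-oo] along [z + k v], [z] feasible. *)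
Lemma recession_objective_ge0 (R : realType) (n : nat) (a : 'cV[int]_n)
    (c : 'cV[rat]_n) (b : int) (v : 'I_n -> nat) :
  feasible_bounded R c a b -> \sum_i a i 0 * (v i)%:Z = 0 ->
  0 <= \sum_i c i 0 * (v i)%:R.
Proof.
move=> [[x xb] [l lP]] v0; have [z xz] := feasible_natv xb.
move: xb; rewrite {x}xz => /natv_feasible zb.
rewrite leNgt; apply/negP; set s := \sum_i _ => s0.
have s0R : 0 < - ratr s :> R by rewrite oppr_gt0 ltrq0.
have key (k : nat) : l <= objective c (natv R z) + k%:R * ratr s.
  have E : objective c (natv R z) + k%:R * ratr s =
      objective c (natv R (fun i => z i + k * v i)%N).
    rewrite !objective_natv -(ratr_nat R k) -rmorphM -rmorphD /=; congr ratr.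
    rewrite mulr_sumr -big_split; apply: eq_bigr => i _ /=.
    by rewrite natrD natrM mulrDr mulrCA.
  rewrite E; apply: lP; exists (natv R (fun i => z i + k * v i)%N) => //.
  apply/natv_feasible; under eq_bigr do rewrite PoszD PoszM mulrDr mulrCA.
  by rewrite big_split /= zb -mulr_sumr v0 mulr0 addr0.
have := archi_boundP (normr_ge0 ((objective c (natv R z) - l) / - ratr s)).
set k := Num.bound _ => /(le_lt_trans (ler_norm _)); rewrite ltr_pdivrMr//.
by have := key k; lra.
Qed.

(** Duality with a single dual variable: the least ratio [c i / a i] over positive [a i] is dual
    feasible, and the vertex [(b / a j) e_j] attains its dual value. *)
Lemma LP_vertex (R : realType) (n : nat) (a : 'cV[int]_n)
    (c : 'cV[rat]_n) (b : int) (p : 'I_n) :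
  (forall i, a i 0 != 0) -> feasible_bounded R c a b -> 0 <= b -> 0 < a p 0 ->
  exists2 j, 0 < a j 0 &
    LP R c a b = (ratr (c j 0 / (a j 0)%:~R * b%:~R))%:E.
Proof.
move=> a0 fb b0 ap0.
pose ratio i : rat := c i 0 / (a i 0)%:~R.
have [j aj0 jmin] := @Order.TotalTheory.arg_minP _ _ _ p (fun i => 0 < a i 0) ratio ap0.
have aj0Q : 0 < (a j 0)%:~R :> rat by rewrite ltr0z.
(* [ratio j] is dual feasible: for [a i 0 < 0] this is the boundedness along
   the circuit [`|a_i| e_j + a_j e_i]. *)
have dual i : ratio j * (a i 0)%:~R <= c i 0.
  have [ai|] := ltP 0 (a i 0).
    by rewrite -ler_pdivlMr ?ltr0z// jmin.
  rewrite le_eqVlt (negPf (a0 i)) /= => ai.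
  pose v k := (absz (a i 0%R) * (k == j) + absz (a j 0%R) * (k == i))%N.
  have ij : i != j by apply: contraTneq ai => ->; rewrite -leNgt ltW.
  have sumv (T : comPzRingType) (f : 'I_n -> T) : \sum_k f k * (v k)%:R =
      f j * (absz (a i 0))%:R + f i * (absz (a j 0))%:R.
    rewrite (bigD1 j)// (bigD1 i)//= big1 ?addr0 => [|k /andP[/negPf kj /negPf ki]].
      by rewrite /v eqxx [j == i]eq_sym (negPf ij) eqxx !muln0 !muln1 addn0.
    by rewrite /v kj ki !muln0 mulr0.
  have := recession_objective_ge0 (v := v) fb.
  rewrite sumv; under eq_bigr do rewrite -natz.
  rewrite sumv !natz => /(_ ltac:(lia)).
  rewrite !pmulrn ltz0_abs// gtz0_abs// rmorphN mulrN addrC subr_ge0.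
  by rewrite /ratio mulrAC ler_pdivrMr.
exists j => //; pose x : 'cV[R]_n := \col_i ((b%:~R / (a j 0)%:~R) *+ (i == j)).
have aj0R : 0 < (a j 0)%:~R :> R by rewrite ltr0z.
have sumx (f : 'I_n -> R) : \sum_i f i * x i 0 = f j * (b%:~R / (a j 0)%:~R).
  rewrite (bigD1 j)//= big1 ?mxE ?eqxx ?addr0// => i /negPf ij.
  by rewrite mxE ij mulr0.
have xval : objective c x = ratr (ratio j * b%:~R).
  rewrite objectiveE sumx !rmorphM /= fmorphV /= !ratr_int.
  by rewrite mulrCA mulrC -mulrA.
rewrite -/(ratio j) -xval; apply: (ereal_inf_min (f := objective c)).
  apply/polyhedronE; split=> [i|]; last by rewrite sumx mulrC divfK// gt_eqF.
  by rewrite mxE mulrn_wge0// divr_ge0 ?ler0z// ltW.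
(* Weak duality, term by term: [ratio j * a i * y i <= c i * y i]. *)
move=> y /polyhedronE[y0 yb]; rewrite xval rmorphM /= ratr_int -yb mulr_sumr.
rewrite objectiveE ler_sum// => i _; rewrite mulrA ler_wpM2r//.
by rewrite -(ratr_int R (a i 0)) -rmorphM ler_rat.
Qed.

Lemma mulr_prod_denq (n : nat) (c : 'cV[rat]_n) (i : 'I_n) :
  c i 0 * (\prod_k denq (c k 0))%:~R \is a Num.int.
Proof. by rewrite (bigD1 i)//= intrM mulrA -numqE rpredM ?intr_int. Qed.

(** The product of the denominators of [c] clears those of all objective values at integer points,
    so [discrete_min] applies. *)
Lemma IP_attained (R : realType) (n : nat) (a : 'cV[int]_n) (c : 'cV[rat]_n) (b : int) :
  feasible_bounded R c a b ->
  exists z : 'I_n -> nat, [/\ \sum_i a i 0 * (z i)%:Z = b,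
    IP R c a b = (ratr (\sum_i c i 0 * (z i)%:R))%:E &
    forall z' : 'I_n -> nat, \sum_i a i 0 * (z' i)%:Z = b ->
      \sum_i c i 0 * (z i)%:R <= \sum_i c i 0 * (z' i)%:R].
Proof.
move=> [[x0 x0b] [l lP]]; pose d : rat := (\prod_k denq (c k 0))%:~R.
have d0 : 0 < d by rewrite ltr0z prodr_gt0.
have [|||_ [x xb <-] xmin] := discrete_min (d := ratr d) _ _ lP.
- by rewrite ltr0q.
- by exists (objective c x0), x0.
- move=> _ [x /feasible_natv[z ->] <-]; rewrite objective_natv -rmorphM /=.
  suff /intrP[m ->] : d * (\sum_i c i 0 * (z i)%:R) \is a Num.int.
    by rewrite ratr_int intr_int.
  rewrite mulr_sumr rpred_sum// => i _.
  by rewrite mulrA rpredM ?natr_int// mulrC mulr_prod_denq.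
have [z xz] := feasible_natv xb; rewrite {x}xz in xb xmin.
have zmin (z' : 'I_n -> nat) : \sum_i a i 0 * (z' i)%:Z = b ->
    objective c (natv R z) <= objective c (natv R z').
  by move=> z'b; apply: xmin; exists (natv R z') => //; apply/natv_feasible.
exists z; split; first exact/natv_feasible/xb.
  rewrite -objective_natv; apply: (ereal_inf_min (f := objective c)) => // y yb.
  by apply: xmin; exists y.
by move=> z' /zmin; rewrite !objective_natv ler_rat.
Qed.

(** * The integrality gap at one right-hand side *)

(** A common multiple of the denominators of all [IG] values: the first product clears [IP], and
    [LP] at the vertex of [j] needs a further [a j]. Taking every [a i] makes it independent of the
    vertex. *)
Definition gap_denominator (n : nat) (a : 'cV[int]_n) (c : 'cV[rat]_n) : int :=
  (\prod_i denq (c i 0)) * \prod_i a i 0.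

Lemma IG_value_pos (R : realType) (n : nat) (a : 'cV[int]_n) (c : 'cV[rat]_n)
    (A : nat) (b : int) (p : 'I_n) :
  (forall i, a i 0 != 0) -> (forall i, (`|a i 0%R| <= A)%N) ->
  feasible_bounded R c a b -> 0 <= b -> 0 < a p 0 ->
  exists q : rat, [/\ IG R c a b = (ratr q)%:E, q <= (A%:R - 1) * l1norm c &
    q * (gap_denominator a c)%:~R \is a Num.int].
Proof.
move=> a0 aA fb b0 ap0.
have [j aj0 LPE] := LP_vertex a0 fb b0 ap0.
have [z0 [z0b IPE z0min]] := IP_attained fb.
have aj0Q : 0 < (a j 0)%:~R :> rat by rewrite ltr0z.
exists (\sum_i c i 0 * (z0 i)%:R - c j 0 / (a j 0)%:~R * b%:~R); split.
- by rewrite /IG IPE LPE -EFinB rmorphB.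
(* The optimum [z0] serves only as a feasible start. The cost of the nearby point [z] bounds the
   optimal one from above, and its distance to the vertex is estimated coordinatewise. *)
- have [z [zb zA zj]] := proximity a0 aA b0 aj0 z0b.
  rewrite (le_trans (lerB (z0min _ zb) (lexx _)))//.
  rewrite (bigD1 j)//= addrAC /l1norm mulr_sumr [leRHS](bigD1 j)//= lerD//.
    rewrite -mulrA -mulrBr (le_trans (ler_norm _))// normrM mulrC ler_wpM2r//.
    rewrite -(ler_pM2r aj0Q) -[X in _ * X <= _](gtr0_norm aj0Q) -normrM mulrBl.
    rewrite [_^-1 * _]mulrC divfK ?gt_eqF//.
    move: zj; rewrite -(ler_int rat) intr_norm !(rmorphM, rmorphB) /=.
    by rewrite [(a j 0)%:~R * _]mulrC.
  rewrite ler_sum// => i ij; rewrite (le_trans (ler_norm _))// normrM mulrC.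
  by rewrite ler_wpM2r// normr_nat lerBrDr natr1 ler_nat zA.
- rewrite /gap_denominator intrM mulrBl rpredB//.
    rewrite mulrA rpredM ?intr_int// mulr_suml rpred_sum// => i _.
    by rewrite mulrAC rpredM ?natr_int// mulr_prod_denq.
  (* The factor [a j] is isolated to cancel the division in the vertex value. *)
  rewrite [X in _ * (_ * X%:~R)](bigD1 j)//= intrM.
  set x := c j 0; set y := _%:~R; set w := b%:~R; set d := (\prod_i denq _)%:~R.
  set r := (\prod_(i | i != j) _)%:~R.
  have -> : x / y * w * (d * (y * r)) = x * d * w * r.
    by field; rewrite gt_eqF.
  by rewrite rpredM ?intr_int// rpredM ?intr_int//; exact: mulr_prod_denq.
Qed.

Lemma feasible_setN (R : realType) (n : nat) (a : 'cV[int]_n) (b : int) :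
  knapsack_feasible_set R (- a) (- b) = knapsack_feasible_set R a b.
Proof. by rewrite /knapsack_feasible_set polyhedronN. Qed.

Lemma feasible_boundedN (R : realType) (n : nat) (a : 'cV[int]_n)
    (c : 'cV[rat]_n) (b : int) :
  feasible_bounded R c (- a) (- b) = feasible_bounded R c a b.
Proof. by rewrite /feasible_bounded /= feasible_setN. Qed.

Lemma IGN (R : realType) (n : nat) (a : 'cV[int]_n) (c : 'cV[rat]_n) (b : int) :
  IG R c (- a) (- b) = IG R c a b.
Proof. by rewrite /IG /IP /LP feasible_setN polyhedronN. Qed.

Lemma gap_denominatorN (n : nat) (a : 'cV[int]_n) (c : 'cV[rat]_n) :
  gap_denominator (- a) c = (-1) ^+ n * gap_denominator a c.
Proof.
rewrite /gap_denominator mulrCA; congr (_ * _).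
under eq_bigr do rewrite mxE -mulN1r.
by rewrite big_split /= prodr_const card_ord.
Qed.

(** Negating [(a, b)] if necessary gives [0 <= b] and a positive coefficient. If all coefficients
    share a sign, feasibility fixes the sign of [b]; if both signs occur, the sign of [b]
    decides. *)
Lemma IG_value (R : realType) (n : nat) (a : 'cV[int]_n) (c : 'cV[rat]_n)
    (A : nat) (b : int) :
  (0 < n)%N -> (forall i, a i 0 != 0) -> (forall i, (`|a i 0%R| <= A)%N) ->
  feasible_bounded R c a b ->
  exists q : rat, [/\ IG R c a b = (ratr q)%:E, q <= (A%:R - 1) * l1norm c &
    q * (gap_denominator a c)%:~R \is a Num.int].
Proof.
move=> n0 a0 aA fb.
have neg (p : 'I_n) : b <= 0 -> a p 0 < 0 ->
  exists q : rat, [/\ IG R c a b = (ratr q)%:E, q <= (A%:R - 1) * l1norm c &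
    q * (gap_denominator a c)%:~R \is a Num.int].
  move=> b0 ap0; have [|||||q [qE qb qd]] := @IG_value_pos R n (- a) c A (- b) p.
  - by move=> i; rewrite mxE oppr_eq0.
  - by move=> i; rewrite mxE abszN.
  - by rewrite feasible_boundedN.
  - by rewrite oppr_ge0.
  - by rewrite mxE oppr_gt0.
  exists q; split=> //; first by rewrite -IGN.
  move: qd; rewrite gap_denominatorN intrM mulrCA rmorphXn rmorphN1.
  by rewrite -signr_odd; case: odd; rewrite ?mul1r// mulN1r rpredN.
have [z [zb _ _]] := IP_attained fb.
have sum_ge0 : (forall i, 0 < a i 0) -> 0 <= b.
  by move=> pos; rewrite -zb sumr_ge0// => i _; rewrite mulr_ge0// ltW.
have sum_le0 : (forall i, a i 0 < 0) -> b <= 0.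
  by move=> pos; rewrite -zb sumr_le0// => i _; rewrite mulr_le0_ge0// ltW.
have [/existsP[p ap]|/existsPn nopos] := boolP [exists p, 0 < a p 0];
  have [/existsP[m am]|/existsPn noneg] := boolP [exists m, a m 0 < 0].
- have [b0|/ltW b0] := leP 0 b; first exact: IG_value_pos fb b0 ap.
  exact: neg b0 am.
- apply: IG_value_pos fb _ ap => //; apply: sum_ge0 => i.
  by have := noneg i; have := a0 i; lia.
- apply: (neg m) => //; apply: sum_le0 => i.
  by have := nopos i; have := a0 i; lia.
- by have := noneg (Ordinal n0); have := nopos (Ordinal n0);
     have := a0 (Ordinal n0); lia.
Qed.

(** * The gap as an attained maximum *)

Lemma Gap_attained (R : realType) (n : nat) (a : 'cV[int]_n) (c : 'cV[rat]_n) (A : nat) :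
  (0 < n)%N -> (forall i, a i 0 != 0) -> (forall i, (`|a i 0%R| <= A)%N) ->
  feasible_bounded R c a !=set0 ->
  exists q : rat, [/\ Gap R c a = (ratr q)%:E, q <= (A%:R - 1) * l1norm c &
    forall b, feasible_bounded R c a b -> (IG R c a b <= (ratr q)%:E)%E].
Proof.
move=> n0 a0 aA [b0 fb0].
have val b (fb : feasible_bounded R c a b) := IG_value n0 a0 aA fb.
(* The absolute value is taken because the product of the [a i] may be negative. *)
pose d : rat := `|(gap_denominator a c)%:~R|.
have d0 : 0 < d.
  rewrite normr_gt0 intr_eq0 mulf_neq0//; last by apply/prodf_neq0 => i _; exact: a0.
  by rewrite gt_eqF// prodr_gt0.
(* Maximising the gap is minimising its opposite, whose values have the common denominator [d]. *)
have [|||q [b fb IGq] qmax] := @discrete_min rat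
  [set q | exists2 b, feasible_bounded R c a b & IG R c a b = (ratr (- q))%:E]
  d (- ((A%:R - 1) * l1norm c)) d0.
- by have [q [qE _ _]] := val _ fb0; exists (- q), b0; rewrite ?opprK.
- move=> q [b fb]; have [q' [-> q'b _]] := val _ fb.
  by case=> /(fmorph_inj (ratr : {rmorphism rat -> R})) E; rewrite lerNl -E.
- move=> q [b fb]; have [q' [-> _ q'd]] := val _ fb.
  case=> /(fmorph_inj (ratr : {rmorphism rat -> R})) E.
  rewrite -[q]opprK -E mulrN rpredN /d mulrC.
  by case: (ger0P (gap_denominator a c)%:~R) => _; rewrite ?mulrN ?rpredN.
have IGle b' : feasible_bounded R c a b' -> (IG R c a b' <= (ratr (- q))%:E)%E.
  move=> fb'; have [q' [q'E _ _]] := val _ fb'.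
  rewrite q'E lee_fin ler_rat lerNr; apply: qmax.
  by exists b'; rewrite ?opprK.
exists (- q); split=> //; last first.
  have [q' [q'E q'b _]] := val _ fb; move: q'E; rewrite IGq.
  by case=> /(fmorph_inj (ratr : {rmorphism rat -> R})) ->.
(* [emax] selects by choice, so the greatest element must also be shown unique. *)
apply: xget_unique => [|y [[b' fb' <-] ub]].
  split; first by exists b.
  by move=> _ [b' fb' <-]; exact: IGle.
by apply/eqP; rewrite eq_le IGle//= -IGq; apply: ub; exists b.
Qed.

(** * The maximum norm and the extremal family *)

Lemma absz_le_mx_norm (n : nat) (a : 'cV[int]_n) (i : 'I_n) :
  (`|a i 0%R| <= `|mx_norm a|)%N.
Proof.
rewrite -lez_nat !abszE mx_normrE.
have le : `|a i 0| <= \big[Num.max/0]_ij `|a ij.1 ij.2|.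
  exact: (le_bigmax _ (fun ij : 'I_n * 'I_1 => `|a ij.1 ij.2|) (i, 0)).
by rewrite (le_trans le)// ler_norm.
Qed.

Lemma mx_norm_natr (n : nat) (a : 'cV[int]_n) :
  (mx_norm a)%:~R = (absz (mx_norm a))%:R :> rat.
Proof.
by rewrite pmulrn gez0_abs// mx_normrE bigmax_ge_id.
Qed.

Theorem corollary1 (R : realType) :
  (forall (n : nat) (a : 'cV[int]_n) (c : 'cV[rat]_n),
      (2 <= n)%N ->
      (forall i : 'I_n, a i 0 != 0) ->
      gcdv a = 1%N ->
      feasible_bounded R c a !=set0 ->
      (Gap R c a <= (ratr (((mx_norm a)%:~R - 1) * l1norm c))%:E)%E)
  /\
  (forall (k n : nat),
      (0 < k)%N -> (2 <= n)%N ->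
      exists (a : 'cV[int]_n) (c : 'cV[rat]_n),
        [/\ forall i : 'I_n, a i 0 != 0,
            gcdv a = 1%N,
            mx_norm a = k%:Z,
            feasible_bounded R c a !=set0 &
            Gap R c a = (ratr (((mx_norm a)%:~R - 1) * l1norm c))%:E]).
Proof.
split=> [n a c n2 a0 _ fb|k [|[|n]]// k0 _].
  have [q [-> qb _]] := Gap_attained (ltnW n2) a0 (absz_le_mx_norm a) fb.
  by rewrite lee_fin ler_rat mx_norm_natr.
(* Only coordinate [m] has a cost; the others supply multiples of [k] for free. *)
pose m : 'I_n.+2 := ord_max.
pose a : 'cV[int]_n.+2 := \col_i (if i == m then 1 else k%:Z).
pose c : 'cV[rat]_n.+2 := \col_i (i == m)%:R.
have am : a m 0 = 1 by rewrite mxE eqxx.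
have aNm i : i != m -> a i 0 = k by rewrite mxE => /negPf->.
have m0 : ord0 != m by [].
have a0 i : a i 0 != 0.
  by have [->|/aNm->] := eqVneq i m; rewrite ?am// -lt0n.
have normc : l1norm c = 1.
  rewrite /l1norm (bigD1 m)//= big1 ?addr0 => [|i /negPf im]; rewrite mxE.
    by rewrite eqxx normr1.
  by rewrite im normr0.
have norma : mx_norm a = k.
  apply/le_anti/andP; split; rewrite mx_normrE.
    apply/bigmax_leP; split=> // -[i j] _ /=; rewrite ord1.
    by have [->|/aNm->] := eqVneq i m; rewrite ?am.
  rewrite -(aNm _ m0) (le_trans (ler_norm _))//.
  exact: (le_bigmax _ (fun ij : 'I_n.+2 * 'I_1 => `|a ij.1 ij.2|) (ord0, 0)).
have objm x : objective c x = x m 0 :> R.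
  rewrite objectiveE (bigD1 m)//= big1 ?addr0 => [|i /negPf im]; rewrite mxE.
    by rewrite eqxx rmorph1 mul1r.
  by rewrite im rmorph0 mul0r.
(* The largest residue modulo [k], too small to use any coefficient [k] integrally. *)
pose b : int := k.-1%:Z.
have fb : feasible_bounded R c a b.
  split.
    exists (natv R (fun i => if i == m then k.-1 else 0%N)); apply/natv_feasible.
    rewrite (bigD1 m)//= big1 ?addr0 => [|i /negPf->]; last by rewrite mulr0.
    by rewrite eqxx am mul1r.
  by exists 0 => _ [x [/polyhedronE[x0 _] _] <-]; rewrite objm.
have fb0 : feasible_bounded R c a !=set0 by exists b.
exists a, c; split=> //.
  by apply/eqP; rewrite /gcdv (bigD1 m)//= am -dvdn1 dvdn_gcdl.
have [q [GE qb IGle]] := Gap_attained (ltn0Sn _) a0 (absz_le_mx_norm a) fb0.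
rewrite GE; congr EFin; congr ratr; apply/le_anti; rewrite mx_norm_natr qb/=.
rewrite -mx_norm_natr norma normc mulr1.
(* The upper bound is [qb]; for the lower one it suffices that [IG] at [b] is at least [k - 1]. *)
rewrite -(ler_rat R) -lee_fin; apply: le_trans (IGle _ fb).
have [z [zb IPE _]] := IP_attained fb.
(* In natural numbers [z m + k * s = k - 1] forces [s = 0]. *)
have zm : (k.-1 <= z m)%N.
  move: zb; rewrite (bigD1 m)//= am mul1r.
  under eq_bigr => i im do rewrite aNm//.
  rewrite -mulr_sumr -Posz_sum /b.
  by case: (\sum_(i | i != m) z i)%N => [|s]; nia.
(* The relaxation has value at most 0, by the cost-free point [((k - 1) / k) e_0]. *)
rewrite /IG -[leLHS]sube0; apply: leeB; last first.
  apply: ereal_inf_lbound; exists (\col_i ((k.-1%:R / k%:R) *+ (i == ord0))).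
    have kR : (k%:R : R) != 0 by rewrite pnatr_eq0 -lt0n.
    apply/polyhedronE; split=> [i|]; first by rewrite mxE mulrn_wge0.
    rewrite (bigD1 ord0)//= big1 ?addr0 => [|i /negPf i0]; last first.
      by rewrite [X in _ * X]mxE i0 mulr0.
    by rewrite (aNm _ m0) mxE eqxx mulr1n mulrC divfK.
  by rewrite objm mxE.
rewrite IPE lee_fin ler_rat (bigD1 m)//= big1 ?addr0 => [|i /negPf im].
  by rewrite mxE eqxx mul1r lerBlDr natr1 -[k%:~R]/(k%:R) ler_nat; lia.
by rewrite mxE im mul0r.
Qed.
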